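(* In the absence of constraints, the optimal solutions respectively obtained by MPC (model predictive control) and by LQR (linear quadratic regulator), both defined in the context, coincide. That is, at each time $t\in\{0,\delta t,\dots,T-\delta t\}$ and from the state $X_t=(p_t,q_t)^T$, the MPC control $\tilde u_t^*=\bar u_t$, where $$(\bar u_t,\bar u_{t+\delta t},\dots,\bar u_{T-\delta t})=\operatorname*{argmin}_{u_t,\dots,u_{T-\delta t}\in\mathbb R}C_t(u_t,u_{t+\delta t},\dots,u_{T-\delta t})$$ is the unconstrained minimizer of the certainty-equivalent cost, equals the LQR optimal control $u_t^*=k_t^TX_t+f_t$.
   Context: Time grid: $0,\delta t,\dots,n\delta t=T$; sums over time run over the grid. Parameters (deterministic): $Q_0$, $v_t$, $a_t=v_t/Q_0$, $\eta_t$, $\mu_t$, $w_t=(Q_0\mu_t,-1)^T$, $s_t$, $\kappa_t$, $\alpha_t$, $\beta_t$, $\sigma_{t,\delta t}$ and $\tilde\beta_T$ (respectively: initial quantity, expected market volume rate, its ratio to $Q_0$, temporary impact, permanent impact, impact vector, half-spread, mean-reversion, trend, urgency, volatility, terminal penalty). The $z_t$ are i.i.d. standard normal. $\mathcal I=\mathrm{diag}(1,1)$, $\mathcal J=\mathrm{diag}(1,0)$, $e_1=(1,0)^T$. LQR problem: state $X_t=(p_t,q_t)^T$ with $$X_{t+\delta t}=(\mathcal I-\kappa_t\delta t\mathcal J)X_t+a_tu_tw_t\delta t+(\alpha_t\delta t+\sigma_{t,\delta t}z_t)e_1;$$ minimize over real controls $\mathbb E\big[\sum_{\tau=t}^{T-\delta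 t}j_\tau(X_\tau,u_\tau)\delta t+\tilde\beta_Tq_T^2\mid X_t\big]$, where $j_\tau(X,u)=a_\tau\eta_\tau u^2+a_\tau(p+s_\tau)u+\beta_\tau q^2$ for $X=(p,q)^T$. The LQR optimal control is $u_t^*=k_t^TX_t+f_t$, where $P_T=\mathrm{diag}(0,\tilde\beta_T)$, $b_T=0$, and backward in time, with $\Delta_t=\mathrm{diag}(0,\beta_t)$, $$g_t=\eta_t+a_tw_t^TP_{t+\delta t}w_t\delta t,\quad k_t=-\tfrac1{g_t}\big((\mathcal I-\kappa_t\delta t\mathcal J)P_{t+\delta t}^Tw_t+\tfrac12e_1\big),\quad f_t=-\frac{[b_{t+\delta t}^T+2\alpha_t\delta t\,e_1^TP_{t+\delta t}]w_t+s_t}{2g_t},$$ $$P_t=P_{t+\delta t}-\kappa_t\delta t(\mathcal JP_{t+\delta t}+P_{t+\delta t}\mathcal J)+\kappa_t^2(\delta t)^2\mathcal JP_{t+\delta t}\mathcal J+[\Delta_t-a_tg_tk_tk_t^T]\delta t,$$ $$b_t=b_{t+\delta t}-\{2a_tg_tf_tk_t+\kappa_t\mathcal Jb_{t+\delta t}-2\alpha_t(\mathcal I-\kappa_t\delta t\mathcal J)P_{t+\delta t}e_1\}\delta t.$$ MPC policy: at time $t$ in state $X_t$, consider the certainty-equivalent dynamics obtained by setting $\sigma_{\cdot,\delta t}=0$, namely $X_{\tau+\delta t}=(\mathcal I-\kappa_\tau\delta t\mathcal J)X_\tau+a_\tau u_\tau w_\tau\delta t+\alpha_\tau e_1\delta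 t$ for $\tau=t,\dots,T-\delta t$, and the deterministic cost $$C_t(u_t,\dots,u_{T-\delta t})=\sum_{\tau=t}^{T-\delta t}j_\tau(X_\tau,u_\tau)\delta t+\tilde\beta_Tq_T^2 .$$ Minimize $C_t$ over $(u_t,\dots,u_{T-\delta t})$ (in general subject to linear constraints such as $u_\tau\ge0$; here without constraints), use the first component $\bar u_t$ of the minimizer as the control at time $t$, discard the others, and repeat at time $t+\delta t$ from the new state. *)

(* Defs.v *)
From mathcomp Require Import all_boot all_order all_algebra.
From mathcomp Require Import reals.

Set Implicit Arguments.
Unset Strict Implicit.
Unset Printing Implicit Defensive.

Import Order.TTheory GRing.Theory Num.Theory.
Local Open Scope ring_scope.

(* The index i : nat stands for the grid time i * dt; the horizon is
   T = steps * dt.  Time-dependent parameters are only used for i < steps. *)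
Record market (R : realType) := Market {
  steps  : nat;
  dt     : R;
  Q0     : R;        (* initial quantity *)
  volume : nat -> R; (* expected market volume rate v *)
  eta    : nat -> R; (* temporary impact *)
  mu     : nat -> R; (* permanent impact *)
  spread : nat -> R; (* half-spread s *)
  kappa  : nat -> R; (* mean reversion *)
  alpha  : nat -> R; (* trend *)
  beta   : nat -> R; (* urgency *)
  sigma  : nat -> R; (* volatility over one time step *)
  betaT  : R         (* terminal penalty *)
}.

Section Vectors.
Context {R : realType}.

Definition vec2 (x y : R) : 'cV[R]_2 := \col_i (if i == 0 then x else y).
Definition diag2 (x y : R) : 'M[R]_2 := diag_mx (vec2 x y)^T.
Definition e1 : 'cV[R]_2 := vec2 1 0.
Definition Imx : 'M[R]_2 := diag2 1 1.
Definition Jmx : 'M[R]_2 := diag2 1 0.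

Definition price (X : 'cV[R]_2) : R := X 0 0.
Definition quantity (X : 'cV[R]_2) : R := X 1 0.

(* Identifies a 1 x 1 matrix, such as u^T *m v, with its entry. *)
Definition scal (A : 'M[R]_1) : R := A 0 0.

End Vectors.

Section Problem.
Context {R : realType}.
Implicit Types (M : market R) (X : 'cV[R]_2) (i t m : nat) (u : nat -> R).

Definition vol_ratio M i : R := volume M i / Q0 M.

Definition impact M i : 'cV[R]_2 := vec2 (Q0 M * mu M i) (-1).

Definition reversion M i : 'M[R]_2 := Imx - (kappa M i * dt M) *: Jmx.

(* One step of the controlled dynamics from time i, with control c and noise
   sample z. *)
Definition next_state M i X (c z : R) : 'cV[R]_2 :=
  reversion M i *m X + (vol_ratio M i * c * dt M) *: impact M i
  + (alpha M i * dt M + sigma M i * z) *: e1.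

Definition running_cost M i X (c : R) : R :=
  vol_ratio M i * eta M i * c ^+ 2
  + vol_ratio M i * (price X + spread M i) * c
  + beta M i * quantity X ^+ 2.

Definition certainty_equivalent M : market R :=
  {| steps := steps M; dt := dt M; Q0 := Q0 M; volume := volume M;
     eta := eta M; mu := mu M; spread := spread M; kappa := kappa M;
     alpha := alpha M; beta := beta M; sigma := fun=> 0; betaT := betaT M |}.

(* State at time t + m of the certainty-equivalent system started from X at
   time t.  The noise sample 0 is immaterial, as it is multiplied by 0. *)
Fixpoint mpc_state M t X u m : 'cV[R]_2 :=
  if m is m'.+1 then
    next_state (certainty_equivalent M) (t + m')
      (mpc_state M t X u m') (u (t + m')%N) 0
  else X.

Definition mpc_cost M t X u : R :=
  \sum_(t <= i < steps M)
     running_cost M i (mpc_state M t X u (i - t)) (u i) * dt M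
  + betaT M * quantity (mpc_state M t X u (steps M - t)) ^+ 2.

(* Control sequences are functions on nat of which mpc_cost only reads the
   components t, ..., steps M - 1. *)
Definition mpc_argmin M t X u : Prop :=
  forall u', mpc_cost M t X u <= mpc_cost M t X u'.

(* The control c applied by MPC at time t in state X: the first component of
   a minimizing sequence. *)
Definition mpc_control M t X (c : R) : Prop :=
  exists2 u, mpc_argmin M t X u & c = u t.

(* In the next definitions P and b are those of time i + 1. *)

Definition gain_step M i (P : 'M[R]_2) : R :=
  eta M i + vol_ratio M i * scal ((impact M i)^T *m P *m impact M i) * dt M.

Definition slope_step M i (P : 'M[R]_2) : 'cV[R]_2 :=
  - (gain_step M i P)^-1 *:
    (reversion M i *m P^T *m impact M i + 2^-1 *: e1).

Definition intercept_step M i (P : 'M[R]_2) (b : 'cV[R]_2) : R :=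
  - (scal ((b^T + (2 * alpha M i * dt M) *: (e1^T *m P)) *m impact M i)
     + spread M i) / (2 * gain_step M i P).

Definition riccati_step M i (P : 'M[R]_2) : 'M[R]_2 :=
  let k := slope_step M i P in
  P - (kappa M i * dt M) *: (Jmx *m P + P *m Jmx)
  + (kappa M i ^+ 2 * dt M ^+ 2) *: (Jmx *m P *m Jmx)
  + dt M *: (diag2 0 (beta M i)
             - (vol_ratio M i * gain_step M i P) *: (k *m k^T)).

Definition linear_step M i (P : 'M[R]_2) (b : 'cV[R]_2) : 'cV[R]_2 :=
  b - dt M *:
    ((2 * vol_ratio M i * gain_step M i P * intercept_step M i P b)
       *: slope_step M i P
     + kappa M i *: (Jmx *m b)
     - (2 * alpha M i) *: (reversion M i *m P *m e1)).

(* (P, b) at time steps M - m, that is, m steps before the horizon. *)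
Fixpoint backward M m : 'M[R]_2 * 'cV[R]_2 :=
  if m is m'.+1 then
    let: (P, b) := backward M m' in
    (riccati_step M (steps M - m) P, linear_step M (steps M - m) P b)
  else (diag2 0 (betaT M), 0).

Definition lqr_P M i : 'M[R]_2 := (backward M (steps M - i)).1.
Definition lqr_b M i : 'cV[R]_2 := (backward M (steps M - i)).2.
Definition lqr_g M i : R := gain_step M i (lqr_P M i.+1).
Definition lqr_k M i : 'cV[R]_2 := slope_step M i (lqr_P M i.+1).
Definition lqr_f M i : R := intercept_step M i (lqr_P M i.+1) (lqr_b M i.+1).

Definition lqr_control M i X : R := scal ((lqr_k M i)^T *m X) + lqr_f M i.

Lemma lqr_P_last M : lqr_P M (steps M) = diag2 0 (betaT M).
Proof. by rewrite /lqr_P subnn. Qed.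

Lemma lqr_b_last M : lqr_b M (steps M) = 0.
Proof. by rewrite /lqr_b subnn. Qed.

Lemma lqr_P_rec M i : (i < steps M)%N ->
  lqr_P M i = riccati_step M i (lqr_P M i.+1).
Proof.
move=> ltin; rewrite /lqr_P -[(steps M - i)%N]subSS (subSn ltin) /=.
by case: backward => P b /=; rewrite -(subSn ltin) subSS subKn // ltnW.
Qed.

Lemma lqr_b_rec M i : (i < steps M)%N ->
  lqr_b M i = linear_step M i (lqr_P M i.+1) (lqr_b M i.+1).
Proof.
move=> ltin; rewrite /lqr_P /lqr_b -[in LHS](subSS i) (subSn ltin) /=.
by case: backward => P b /=; rewrite -(subSn ltin) subSS subKn // ltnW.
Qed.

End Problem.

(* Main.v *)
(** Completing the square in the Bellman recursion, for arbitrary controls,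
    gives the exact identity
      mpc_cost u = value t X + const
                   + \sum_i dt a_i g_i (u_i - (k_i^T X_i + f_i))^2,
    where X_i is the state reached under u.  The deviations
    d_i = u_i - (k_i^T X_i + f_i) can be prescribed arbitrarily, by running the
    LQR feedback perturbed by d; so the cost is a diagonal quadratic form in
    independent variables.  As the weights are nonzero, every minimizer has
    d = 0, i.e., is the LQR feedback; d = 0 does minimize when they are
    positive. *)

Require Import Defs.
From mathcomp Require Import all_boot all_order all_algebra.
From mathcomp Require Import reals.
From mathcomp Require Import ring lra.

Set Implicit Arguments.
Unset Strict Implicit.
Unset Printing Implicit Defensive.

Import Order.TTheory GRing.Theory Num.Theory.
Local Open Scope ring_scope.

Section Lqr.
Context {R : realType}.
Implicit Types (M : market R) (P : 'M[R]_2) (b X : 'cV[R]_2).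
Implicit Types (i j t m n : nat) (u d : nat -> R).

Lemma sum_ord2 (F : 'I_2 -> R) : \sum_i F i = F 0 + F 1.
Proof.
rewrite big_ord_recl big_ord1; congr (F _ + F _); exact: val_inj.
Qed.

Definition quadratic P b X : R := scal (X^T *m P *m X) + scal (b^T *m X).

(** Symmetry merges the two cross terms of each quadratic form, as completing the square in
    [bellman_step] requires. *)
Lemma riccati_step_sym M i P :
  P^T = P -> (riccati_step M i P)^T = riccati_step M i P.
Proof.
move=> symP; have symJ : (@Jmx R)^T = Jmx by rewrite /Jmx /diag2 tr_diag_mx.
have trD (A B : 'M[R]_2) : (A + B)^T = A^T + B^T by apply: linearD.
have trN (A : 'M[R]_2) : (- A)^T = - A^T by apply: linearN.
have trZ (x : R) (A : 'M[R]_2) : (x *: A)^T = x *: A^T by apply: linearZ.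
rewrite /riccati_step !(trD, trN, trZ, trmx_mul) trmxK symJ symP tr_diag_mx.
by rewrite mulmxA [P *m _ + _]addrC.
Qed.

(** The part of the Bellman identity free of [X] and [c]: the cost-to-go of the pure drift, less the
    square left over at [X = 0], [c = 0]. *)
Definition offset_step M i P b : R :=
  quadratic P b ((alpha M i * dt M) *: e1)
  - dt M * (vol_ratio M i * gain_step M i P) * intercept_step M i P b ^+ 2.

(** The left side is a quadratic polynomial in [c] with leading coefficient [dt * a * g], and its
    vertex is the LQR feedback. No minimum is taken, so the sign of [g] is irrelevant. *)
Lemma bellman_step M i P b X (c : R) : P^T = P -> gain_step M i P != 0 ->
  running_cost M i X c * dt M
    + quadratic P b (next_state (certainty_equivalent M) i X c 0) =
  quadratic (riccati_step M i P) (linear_step M i P b) X + offset_step M i P b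
  + dt M * (vol_ratio M i * gain_step M i P)
    * (c - (scal ((slope_step M i P)^T *m X) + intercept_step M i P b)) ^+ 2.
Proof.
move=> symP g_neq0; have P10 : P 1 0 = P 0 1 by rewrite -[in LHS]symP mxE.
rewrite /offset_step /riccati_step /linear_step.
(* Trading [eta] for [g] lets [g] become an atom, so that [field] only has to know [g != 0]. *)
have eta_eq : eta M i = gain_step M i P
    - vol_ratio M i * scal ((impact M i)^T *m P *m impact M i) * dt M.
  by rewrite /gain_step addrK.
have := erefl (slope_step M i P); have := erefl (intercept_step M i P b).
rewrite {2}/slope_step {2}/intercept_step; move: g_neq0 eta_eq.
move: (gain_step M i P) (slope_step M i P) (intercept_step M i P b).
move=> g k f g_neq0.
rewrite /running_cost /quadratic /next_state /= /reversion /Imx /Jmx /diag2 /e1.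
rewrite /impact /vec2 /scal /price /quantity.
rewrite -[vol_ratio (certainty_equivalent M) i]/(vol_ratio M i).
move: (vol_ratio M i) (Q0 M * mu M i) => a m eta_eq f_eq k_eq.
have k0 : k 0 0 =
    - g^-1 * ((1 - kappa M i * dt M) * (P 0 0 * m - P 0 1) + 2^-1).
  by rewrite k_eq !(mxE, sum_ord2, big_ord1) /= P10; ring.
have k1 : k 1 0 = - g^-1 * (P 0 1 * m - P 1 1).
  by rewrite k_eq !(mxE, sum_ord2, big_ord1) /= ?P10; ring.
clear k_eq; move: eta_eq f_eq.
rewrite !(mxE, sum_ord2, big_ord1) /= k0 k1 P10 ?mulr0n ?mulr1n => -> ->.
by field.
Qed.

Lemma lqr_P_sym M i : (lqr_P M i)^T = lqr_P M i.
Proof.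
rewrite /lqr_P; elim: (steps M - i)%N => [|m IHm] /=; first exact: tr_diag_mx.
by case: backward IHm => P b /= /(riccati_step_sym M).
Qed.

Definition deviation M t X (u : nat -> R) i : R :=
  u i - lqr_control M i (mpc_state M t X u (i - t)).

Definition deviation_weight M i : R := dt M * (vol_ratio M i * lqr_g M i).

Definition value M i X : R := quadratic (lqr_P M i) (lqr_b M i) X.

Definition offset M i : R := offset_step M i (lqr_P M i.+1) (lqr_b M i.+1).

Lemma value_last M X : value M (steps M) X = betaT M * quantity X ^+ 2.
Proof.
rewrite /value lqr_P_last lqr_b_last /quadratic /diag2 /vec2 /scal /quantity.
by rewrite !(mxE, sum_ord2) /= ?mulr0n ?mulr1n; ring.
Qed.

Lemma mpc_cost_deviation M t X u : (t <= steps M)%N ->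
    (forall i, (i < steps M)%N -> lqr_g M i != 0) ->
  mpc_cost M t X u = value M t X + \sum_(t <= i < steps M) offset M i
    + \sum_(t <= i < steps M) deviation_weight M i * deviation M t X u i ^+ 2.
Proof.
move=> le_tn g_neq0; pose Y i := mpc_state M t X u (i - t).
have step i : (t <= i < steps M)%N ->
  running_cost M i (Y i) (u i) * dt M =
    offset M i + deviation_weight M i * deviation M t X u i ^+ 2
    - (value M i.+1 (Y i.+1) - value M i (Y i)).
  case/andP=> le_ti lt_in; have := bellman_step (lqr_b M i.+1) (Y i) (u i)
    (lqr_P_sym M i.+1) (g_neq0 i lt_in).
  rewrite -lqr_P_rec // -lqr_b_rec //.
  rewrite /value [Y i.+1]/Y subSn //= subnKC // -/(Y i) => eq_step.
  by rewrite /offset /deviation_weight /deviation /lqr_control -/(Y i) /lqr_k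
     /lqr_f /lqr_g; lra.
rewrite /mpc_cost (eq_big_nat _ _ step) sumrB big_split /= -/(Y (steps M)).
(* The value differences collapse to the terminal penalty minus the value at the initial state. *)
rewrite (telescope_sumr (fun i => value M i (Y i))) //= value_last.
by rewrite [Y t]/Y subnn /=; ring.
Qed.

(** The feedback depends on the state it produces, so the closed-loop state is built first and the
    control sequence is read off from it. *)
Fixpoint perturbed_state M t X (d : nat -> R) m : 'cV[R]_2 :=
  if m is m'.+1 then
    let Y := perturbed_state M t X d m' in
    next_state (certainty_equivalent M) (t + m') Y
      (lqr_control M (t + m') Y + d (t + m')%N) 0
  else X.

Definition perturbed_control M t X d i : R :=
  lqr_control M i (perturbed_state M t X d (i - t)) + d i.

Lemma mpc_state_perturbed M t X d m :
  mpc_state M t X (perturbed_control M t X d) m = perturbed_state M t X d m.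
Proof. by elim: m => //= m ->; rewrite /perturbed_control addKn. Qed.

Lemma deviation_perturbed M t X d i :
  deviation M t X (perturbed_control M t X d) i = d i.
Proof.
by rewrite /deviation mpc_state_perturbed /perturbed_control addrC addKr.
Qed.

Lemma deviation_weight_neq0 M i :
    dt M != 0 -> Q0 M != 0 -> volume M i != 0 -> lqr_g M i != 0 ->
  deviation_weight M i != 0.
Proof. by move=> *; rewrite !mulf_neq0 ?invr_eq0. Qed.

Lemma mpc_argmin_deviation M t X u i :
    (forall j, (j < steps M)%N -> lqr_g M j != 0) ->
    mpc_argmin M t X u -> (t <= i < steps M)%N -> deviation_weight M i != 0 ->
  deviation M t X u i = 0.
Proof.
move=> g_neq0 u_min i_in w_neq0; have /andP[le_ti lt_in] := i_in.
pose d := deviation M t X u.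
have min_at e : deviation_weight M i * d i ^+ 2 <= deviation_weight M i * e ^+ 2.
  (* Only the deviation at [i] changes, so all other terms of the two costs cancel. *)
  pose d' j := if j == i then e else d j.
  have := u_min (perturbed_control M t X d').
  rewrite !mpc_cost_deviation // ?(leq_trans le_ti (ltnW lt_in)) // lerD2l.
  rewrite !(bigD1_seq i) ?mem_index_iota ?iota_uniq //=.
  rewrite deviation_perturbed {1}/d' eqxx.
  rewrite [X in _ <= _ + X](eq_bigr
    (fun j => deviation_weight M j * d j ^+ 2)) ?lerD2r // => j /negPf ne_ji.
  by rewrite deviation_perturbed /d' ne_ji.
(* Comparing with 0 and with 2 d_i pins d_i whatever the sign of the weight. *)
have := min_at 0; have := min_at (2 * d i) => le2 le0.
have : deviation_weight M i * d i ^+ 2 = 0 by nra.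
by move/eqP; rewrite mulf_eq0 (negPf w_neq0) sqrf_eq0 => /eqP.
Qed.

(** Induction forward in time: equal states give equal feedback controls, which give equal next
    states. *)
Lemma deviation0_uniq M t X u u' n :
    (forall i, (t <= i < n)%N -> deviation M t X u i = 0) ->
    (forall i, (t <= i < n)%N -> deviation M t X u' i = 0) ->
  forall i, (t <= i < n)%N -> u i = u' i.
Proof.
move=> du du'; have eq_state m : (t + m <= n)%N ->
    mpc_state M t X u m = mpc_state M t X u' m.
  elim: m => //= m IHm; rewrite addnS => lt_n; have m_in: (t <= t + m < n)%N.
    by rewrite leq_addr.
  have := du _ m_in; have := du' _ m_in.
  rewrite /deviation addKn (IHm (ltnW lt_n)).
  by move=> /eqP; rewrite subr_eq0 => /eqP-> /eqP; rewrite subr_eq0 => /eqP->.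
move=> i i_in; have /andP[le_ti /ltnW le_in] := i_in.
move/eqP: (du i i_in); move/eqP: (du' i i_in).
by rewrite /deviation !subr_eq0 eq_state ?subnKC // => /eqP-> /eqP->.
Qed.

End Lqr.

Theorem proposition1 (R : realType) (M : market R)
  (dt_gt0 : 0 < dt M)
  (Q0_neq0 : Q0 M != 0)
  (volume_neq0 : forall i, (i < steps M)%N -> volume M i != 0)
  (g_neq0 : forall i, (i < steps M)%N -> lqr_g M i != 0)
  (t : nat) (t_lt : (t < steps M)%N) (X : 'cV[R]_2) :
  (forall c : R, mpc_control M t X c -> c = lqr_control M t X)
  /\
  ((forall i, (t <= i < steps M)%N -> 0 < vol_ratio M i * lqr_g M i) ->
   mpc_control M t X (lqr_control M t X)
   /\ (forall u u' : nat -> R, mpc_argmin M t X u -> mpc_argmin M t X u' ->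
       forall i, (t <= i < steps M)%N -> u i = u' i)).
Proof.
have w_neq0 i : (i < steps M)%N -> deviation_weight M i != 0.
  move=> lt_in; apply: deviation_weight_neq0; rewrite ?volume_neq0 ?g_neq0 //.
  exact: lt0r_neq0.
have dev0 u : mpc_argmin M t X u ->
    forall i, (t <= i < steps M)%N -> deviation M t X u i = 0.
  move=> u_min i i_in; apply: mpc_argmin_deviation => //.
  by apply: w_neq0; case/andP: i_in.
split=> [c [u u_min ->]|w_gt0].
  (* At time [t] the state is still [X], so a zero deviation there is the LQR formula itself. *)
  have t_in : (t <= t < steps M)%N by rewrite leqnn.
  by move/eqP: (dev0 u u_min t t_in); rewrite /deviation subnn subr_eq0 => /eqP.
split=> [|u u' /dev0 du /dev0 du']; last exact: deviation0_uniq du du'.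
exists (perturbed_control M t X (fun=> 0)); last first.
  by rewrite /perturbed_control subnn addr0.
(* With positive weights every square term is nonnegative, and zero deviation makes them all
   vanish. *)
move=> u; rewrite !mpc_cost_deviation ?(ltnW t_lt) // lerD2l big_nat_cond.
rewrite [leRHS]big_nat_cond; apply: ler_sum => i; rewrite andbT => i_in.
rewrite deviation_perturbed expr0n mulr0 mulr_ge0 ?sqr_ge0 //.
by rewrite mulr_ge0 ?ltW // w_gt0.
Qed.
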